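(* For each closed siACP$_{\mathrm{rec}}^+$ term $t$, there exists a closed ACP$_{\mathrm{rec}}$ term $t'$ such that $t = t'$ is derivable from the axioms of siACP$_{\mathrm{rec}}^+$.
   Context: ACP: fix a set $A$ of actions with $\delta \notin A$, $A_\delta = A \cup \{\delta\}$, and a commutative, associative $\gamma: A_\delta \times A_\delta \to A_\delta$ with $\gamma(\delta,a)=\delta$. Signature: constants $a$ ($a\in A$), $\delta$; binary $+$, $\cdot$, $\parallel$, $\lfloor\!\lfloor$ (left merge), $\mid$ (communication merge); unary $\partial_H$ ($H\subseteq A$). Axioms ($a,b$ range over constants from $A_\delta$): A1 $x+y=y+x$; A2 $(x+y)+z=x+(y+z)$; A3 $x+x=x$; A4 $(x+y)\cdot z = x\cdot z+y\cdot z$; A5 $(x\cdot y)\cdot z = x\cdot(y\cdot z)$; A6 $x+\delta=x$; A7 $\delta\cdot x=\delta$; D1 $\partial_H(a)=a$ if $a\notin H$; D2 $\partial_H(a)=\delta$ if $a\in H$; D3 $\partial_H(x+y)=\partial_H(x)+\partial_H(y)$; D4 $\partial_H(x\cdot y)=\partial_H(x)\cdot\partial_H(y)$; CM1 $x\parallel y = x\lfloor\!\lfloor y + y\lfloor\!\lfloor x + x\mid y$; CM2 $a\lfloor\!\lfloor x = a\cdot x$; CM3 $a\cdot x\lfloor\!\lfloor y = a\cdot(x\parallel y)$; CM4 $(x+y)\lfloor\!\lfloor z = x\lfloor\!\lfloor z + y\lfloor\!\lfloor z$; CM5 $a\cdot x\mid b = \gamma(a,b)\cdot x$; CM6 $a\mid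 b\cdot x=\gamma(a,b)\cdot x$; CM7 $a\cdot x\mid b\cdot y = \gamma(a,b)\cdot(x\parallel y)$; CM8 $(x+y)\mid z = x\mid z+y\mid z$; CM9 $x\mid(y+z)=x\mid y+x\mid z$; CM10 $\delta\mid x=\delta$; CM11 $x\mid\delta=\delta$; CM12 $a\mid b=\gamma(a,b)$. siACP: $\mathbb{N}^+$ denotes the positive naturals. The set $\mathcal{H}$ of interleaving histories is the subset of $(\mathbb{N}^+\times\mathbb{N}^+)^*$ defined inductively by: the empty sequence is in $\mathcal{H}$; $\langle i,n\rangle\in\mathcal{H}$ if $i\le n$; if $h\frown\langle i,n\rangle\in\mathcal{H}$, $j\le n$ and $n-1\le m\le n+1$, then $h\frown\langle i,n\rangle\frown\langle j,m\rangle\in\mathcal{H}$. Given are a set $S$ of control states, for each $n\in\mathbb{N}^+$ functions $\mathrm{sched}_n:\mathcal{H}\times S\to\{1,\dots,n\}$ and $\mathrm{upd}_n:\mathcal{H}\times S\times\{1,\dots,n\}\times A\to S$, a set $D$ of data, and a function $\mathrm{cr}$ from $D$ to closed terms (see below); for each $d\in D$ there are actions $\mathrm{pcr}(d),\mathrm{rcr}(d)\in A$ with $\gamma(\mathrm{pcr}(d),a)=\delta$ and $\gamma(a,b)\ne\mathrm{pcr}(d)$ for all $a,b\in A$. The signature of siACP is that of ACP plus, for each $n\in\mathbb{N}^+$, $h\in\mathcal{H}$, $s\in S$, an $n$-ary operator $\|^n_{h,s}$, and for each $n,i\in\mathbb{N}^+$, $i\le n$, $h\in\mathcal{H}$, $s\in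 S$, an $n$-ary operator $\pi^n_{i,h,s}$. Its axioms are those of ACP plus (with $n,i\in\mathbb{N}^+$, $i\le n$, $h\in\mathcal{H}$, $s\in S$, $d\in D$, $a$ any action constant from $A$ not of the form $\mathrm{pcr}(d)$ or $\mathrm{rcr}(d)$): SI1 $\|^n_{h,s}(x_1,\dots,x_n)=\pi^n_{\mathrm{sched}_n(h,s),h,s}(x_1,\dots,x_n)$; SI2 $\pi^n_{i,h,s}(x_1,\dots,x_{i-1},\delta,x_{i+1},\dots,x_n)=\delta$; SI3 $\pi^1_{i,h,s}(a)=a$; SI4 $\pi^{n+1}_{i,h,s}(x_1,\dots,x_{i-1},a,x_{i+1},\dots,x_{n+1}) = a\cdot\|^n_{h\frown\langle i,n\rangle,\mathrm{upd}_{n+1}(h,s,i,a)}(x_1,\dots,x_{i-1},x_{i+1},\dots,x_{n+1})$; SI5 $\pi^n_{i,h,s}(x_1,\dots,x_{i-1},a\cdot x'_i,x_{i+1},\dots,x_n) = a\cdot\|^n_{h\frown\langle i,n\rangle,\mathrm{upd}_n(h,s,i,a)}(x_1,\dots,x_{i-1},x'_i,x_{i+1},\dots,x_n)$; SI6 $\pi^n_{i,h,s}(x_1,\dots,x_{i-1},\mathrm{pcr}(d),x_{i+1},\dots,x_n) = \mathrm{rcr}(d)\cdot\|^n_{h\frown\langle i,n\rangle,\mathrm{upd}_n(h,s,i,\mathrm{pcr}(d))}(x_1,\dots,x_{i-1},x_{i+1},\dots,x_n,\mathrm{cr}(d))$; SI7 $\pi^n_{i,h,s}(x_1,\dots,x_{i-1},\mathrm{pcr}(d)\cdot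 x'_i,x_{i+1},\dots,x_n) = \mathrm{rcr}(d)\cdot\|^{n+1}_{h\frown\langle i,n+1\rangle,\mathrm{upd}_n(h,s,i,\mathrm{pcr}(d))}(x_1,\dots,x_{i-1},x'_i,x_{i+1},\dots,x_n,\mathrm{cr}(d))$; SI8 $\pi^n_{i,h,s}(x_1,\dots,x_{i-1},x'_i+x''_i,x_{i+1},\dots,x_n) = \pi^n_{i,h,s}(x_1,\dots,x'_i,\dots,x_n)+\pi^n_{i,h,s}(x_1,\dots,x''_i,\dots,x_n)$. Guarded recursion: for $T$ = ACP or siACP, an occurrence of a variable $X$ in a $T$ term $t$ is guarded if $t$ has a subterm $a\cdot t'$ with $a\in A$ and $t'$ containing this occurrence; a term is guarded if all its variable occurrences are guarded. A guarded recursive specification over $T$ is a finite or countably infinite set $E=\{X=t_X\mid X\in V\}$, $V$ a set of variables, where each $t_X$ is either a guarded $T$ term with no variables outside $V$, or a $T$ term rewritable to such a term using the axioms of $T$ in either direction and/or the equations of $E$ other than $X=t_X$ from left to right; $\mathrm{vars}(E)$ is the set of variables in $E$. $T$ with guarded recursion adds a constant $\langle X\mid E\rangle$ for each guarded recursive specification $E$ over $T$ and $X\in\mathrm{vars}(E)$, together with RDP: $\langle X\mid E\rangle=\langle t_X\mid E\rangle$ for $X=t_X\in E$ (where $\langle t\mid E\rangle$ is $t$ with each $Y\in\mathrm{vars}(E)$ replaced by $\langle Y\mid E\rangle$) and RSP: $E\Rightarrow X=\langle X\mid E\rangle$ for $X\in\mathrm{vars}(E)$; derivability is in infinitary conditional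 equational logic. ACP$_{\mathrm{rec}}$ is ACP extended with guarded recursion (over ACP). siACP$_{\mathrm{rec}}^+$ is siACP extended with guarded recursion (over siACP), where $\mathrm{cr}$ is a function from $D$ to the set of all closed terms over the signature of siACP extended with guarded recursion. The same $A$ and $\gamma$ are used in all theories.
   Formalization: SI3–SI5 are taken for all actions a not of the form pcr(d), so rcr(d) is allowed (otherwise π^1(rcr(d)) cannot be eliminated); where h⌢⟨i,n⟩ is not in ℋ, SI4–SI7 use an arbitrary history in its place, since the operator would be undefined. *)

(* Defs.v *)
From Stdlib Require Import Relation_Operators.
From mathcomp Require Import all_boot.

Set Implicit Arguments.
Unset Strict Implicit.
Unset Printing Implicit Defensive.

(* Interleaving histories.  A pair [(i, n)] stands for <i, n> literally:
   positions and numbers of processes are counted from 1. *)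
Inductive history : seq (nat * nat) -> Prop :=
| history_nil : history [::]
| history_one i n : 0 < i -> i <= n -> history [:: (i, n)]
| history_snoc h i n j m :
    history (rcons h (i, n)) ->
    0 < j -> j <= n -> 0 < m -> n - 1 <= m -> m <= n + 1 ->
    history (rcons (rcons h (i, n)) (j, m)).

Definition hist : Type := {h : seq (nat * nat) | history h}.

(* Raw terms over a set [A] of actions and a set [S] of control states.  The
   constants of A_delta are the elements of [option A], with [None] for delta.
   Arities are positive: [Inter n h s ts] is the operator ||^{n+1}_{h,s} and
   [Pos n i h s ts] is the operator pi^{n+1}_{i+1,h,s}.
   [Rec X E] is <X|E>, where a recursive specification over the countable set
   of variables [nat] is a partial function [E]; its domain is vars(E) and
   [E X = Some t] means that X = t is in E.  Here [E] is arbitrary; which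
   constants belong to a signature is determined by [sig_in] below. *)
Inductive term (A S : Type) : Type :=
| Var (X : nat)
| Cst (a : option A)
| Alt (t u : term A S)
| Seq (t u : term A S)
| Par (t u : term A S)
| LMerge (t u : term A S)
| CMerge (t u : term A S)
| Encap (H : A -> Prop) (t : term A S)
| Inter (n : nat) (h : hist) (s : S) (ts : 'I_n.+1 -> term A S)
| Pos (n : nat) (i : 'I_n.+1) (h : hist) (s : S) (ts : 'I_n.+1 -> term A S)
| Rec (X : nat) (E : nat -> option (term A S)).

Arguments Var {A S} X.
Arguments Cst {A S} a.
Arguments Rec {A S} X E.

Declare Scope process_scope.
Delimit Scope process_scope with P.
Bind Scope process_scope with term.
Infix "+" := Alt : process_scope.
Infix "*" := Seq : process_scope.
Notation delta := (Cst None).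
Notation act a := (Cst (Some a)).

Section Terms.
Variables A S : Type.
Local Notation term := (term A S).
Local Open Scope process_scope.

Definition spec : Type := nat -> option term.

Definition in_vars (E : spec) (X : nat) : Prop := E X <> None.

Fixpoint subst (sigma : nat -> term) (t : term) : term :=
  match t with
  | Var X => sigma X
  | Cst a => Cst a
  | Alt t u => Alt (subst sigma t) (subst sigma u)
  | Seq t u => Seq (subst sigma t) (subst sigma u)
  | Par t u => Par (subst sigma t) (subst sigma u)
  | LMerge t u => LMerge (subst sigma t) (subst sigma u)
  | CMerge t u => CMerge (subst sigma t) (subst sigma u)
  | Encap H t => Encap H (subst sigma t)
  | Inter n h s ts => Inter h s (fun j => subst sigma (ts j))
  | Pos n i h s ts => Pos i h s (fun j => subst sigma (ts j))
  | Rec X E => Rec X E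
  end.

(* <t|E> *)
Definition unfold_spec (E : spec) (t : term) : term :=
  subst (fun Y => if E Y is Some _ then Rec Y E else Var Y) t.

Fixpoint vars_in (V : nat -> Prop) (t : term) : Prop :=
  match t with
  | Var X => V X
  | Cst _ => True
  | Alt t u | Seq t u | Par t u | LMerge t u | CMerge t u =>
      vars_in V t /\ vars_in V u
  | Encap _ t => vars_in V t
  | Inter _ _ _ ts | Pos _ _ _ _ ts => forall j, vars_in V (ts j)
  | Rec _ _ => True
  end.

Definition closed (t : term) : Prop := vars_in (fun _ => False) t.

(* [t] is built from the operators of ACP, the interleaving operators provided
   [interleaving] holds, and the recursion constants <X|E> with [K X E]. *)
Fixpoint sig_in (interleaving : Prop) (K : nat -> spec -> Prop) (t : term)
    : Prop :=
  match t with
  | Var _ | Cst _ => True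
  | Alt t u | Seq t u | Par t u | LMerge t u | CMerge t u =>
      sig_in interleaving K t /\ sig_in interleaving K u
  | Encap _ t => sig_in interleaving K t
  | Inter _ _ _ ts | Pos _ _ _ _ ts =>
      interleaving /\ forall j, sig_in interleaving K (ts j)
  | Rec X E => K X E
  end.

Definition acp_term : term -> Prop := sig_in False (fun _ _ => False).
Definition siacp_term : term -> Prop := sig_in True (fun _ _ => False).

Fixpoint const_in (X : nat) (E : spec) (t : term) : Prop :=
  match t with
  | Var _ | Cst _ => False
  | Alt t u | Seq t u | Par t u | LMerge t u | CMerge t u =>
      const_in X E t \/ const_in X E u
  | Encap _ t => const_in X E t
  | Inter _ _ _ ts | Pos _ _ _ _ ts => exists j, const_in X E (ts j)
  | Rec Y F => Y = X /\ F = E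
  end.

(* Every variable occurrence lies in a subterm [t'] of a subterm a . t' with
   [a] in A (so delta is not a guard). *)
Fixpoint guarded (t : term) : Prop :=
  match t with
  | Var _ => False
  | Cst _ | Rec _ _ => True
  | Seq (act _) _ => True
  | Alt t u | Seq t u | Par t u | LMerge t u | CMerge t u =>
      guarded t /\ guarded u
  | Encap _ t => guarded t
  | Inter _ _ _ ts | Pos _ _ _ _ ts => forall j, guarded (ts j)
  end.

(* One-hole contexts *)
Inductive context : (term -> term) -> Prop :=
| ctx_hole : context (fun x => x)
| ctx_alt_l C t : context C -> context (fun x => Alt (C x) t)
| ctx_alt_r C t : context C -> context (fun x => Alt t (C x))
| ctx_seq_l C t : context C -> context (fun x => Seq (C x) t)
| ctx_seq_r C t : context C -> context (fun x => Seq t (C x))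
| ctx_par_l C t : context C -> context (fun x => Par (C x) t)
| ctx_par_r C t : context C -> context (fun x => Par t (C x))
| ctx_lmerge_l C t : context C -> context (fun x => LMerge (C x) t)
| ctx_lmerge_r C t : context C -> context (fun x => LMerge t (C x))
| ctx_cmerge_l C t : context C -> context (fun x => CMerge (C x) t)
| ctx_cmerge_r C t : context C -> context (fun x => CMerge t (C x))
| ctx_encap C H : context C -> context (fun x => Encap H (C x))
| ctx_inter C n h s (ts : 'I_n.+1 -> term) (k : 'I_n.+1) :
    context C -> context (fun x => Inter h s [eta ts with k |-> C x])
| ctx_pos C n i h s (ts : 'I_n.+1 -> term) (k : 'I_n.+1) :
    context C -> context (fun x => Pos i h s [eta ts with k |-> C x]).

(* Rewriting the right-hand side of the equation for [X] in [E] within the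
   terms satisfying [lang]: one step uses an instance of an axiom in either
   direction, or an equation of [E] other than that for [X] from left to
   right. *)
Definition rewrite_step (lang : term -> Prop) (ax : term -> term -> Prop)
    (E : spec) (X : nat) (t u : term) : Prop :=
  [/\ lang t, lang u &
    exists C l r, [/\ context C, t = C l, u = C r &
      [\/ ax l r, ax r l
        | exists Y, [/\ Y <> X, l = Var Y & E Y = Some r]]]].

(* Guarded recursive specifications over a theory with the terms [T_term] and
   the axioms [ax].  Rewriting in zero steps covers the right-hand sides that
   are themselves guarded. *)
Definition guarded_spec (T_term lang : term -> Prop)
    (ax : term -> term -> Prop) (E : spec) : Prop :=
  forall X t, E X = Some t ->
    T_term t /\
    exists u, [/\ clos_refl_trans _ (rewrite_step lang ax E X) t u,
                  T_term u, guarded u & vars_in (in_vars E) u].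

(* (x_1, ..., x_{i-1}, x_{i+1}, ..., x_n) and (x_1, ..., x_n, y) *)
Definition del n (i : 'I_n.+1) (ts : 'I_n.+1 -> term) : 'I_n -> term :=
  fun j => ts (lift i j).
Definition snoc n (ts : 'I_n -> term) (y : term) : 'I_n.+1 -> term :=
  fun j => oapp ts y (unlift ord_max j).

End Terms.

Record acp_params := {
  action : Type;
  gamma : option action -> option action -> option action;
  gammaC : commutative gamma;
  gammaA : associative gamma;
  gamma_delta : forall a, gamma None a = None
}.

(* [hext h p] is the history h^<p> obtained by appending the pair [p].  In
   SI4-SI7 this is formed also when the extended sequence is not an
   interleaving history (for instance <n+1, n> in SI4 for i = n+1 and the empty
   history); [hext] is an arbitrary total completion of the partial append
   operation. *)
Record si_params (P : acp_params) := {
  state : Type;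
  sched : forall n : nat, hist -> state -> 'I_n.+1;
  upd : forall n : nat, hist -> state -> 'I_n.+1 -> action P -> state;
  hext : hist -> nat * nat -> hist;
  hextE : forall h p,
    history (rcons (sval h) p) -> sval (hext h p) = rcons (sval h) p;
  data : Type;
  pcr : data -> action P;
  rcr : data -> action P;
  gamma_pcr : forall d a, gamma (Some (pcr d)) (Some a) = None;
  gamma_neq_pcr : forall d a b, gamma (Some a) (Some b) <> Some (pcr d);
  cr : data -> term (action P) state
}.

Section Theories.
Local Open Scope process_scope.

Inductive acp_ax (P : acp_params) (S : Type) :
    term (action P) S -> term (action P) S -> Prop :=
| A1 x y : acp_ax (x + y) (y + x)
| A2 x y z : acp_ax ((x + y) + z) (x + (y + z))
| A3 x : acp_ax (x + x) x
| A4 x y z : acp_ax ((x + y) * z) (x * z + y * z)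
| A5 x y z : acp_ax ((x * y) * z) (x * (y * z))
| A6 x : acp_ax (x + delta) x
| A7 x : acp_ax (delta * x) delta
| D1 (H : action P -> Prop) (a : option (action P)) :
    ~ (exists2 b, a = Some b & H b) -> acp_ax (Encap H (Cst a)) (Cst a)
| D2 (H : action P -> Prop) (a : action P) :
    H a -> acp_ax (Encap H (act a)) delta
| D3 H x y : acp_ax (Encap H (x + y)) (Encap H x + Encap H y)
| D4 H x y : acp_ax (Encap H (x * y)) (Encap H x * Encap H y)
| CM1 x y : acp_ax (Par x y) ((LMerge x y + LMerge y x) + CMerge x y)
| CM2 a x : acp_ax (LMerge (Cst a) x) (Cst a * x)
| CM3 a x y : acp_ax (LMerge (Cst a * x) y) (Cst a * Par x y)
| CM4 x y z : acp_ax (LMerge (x + y) z) (LMerge x z + LMerge y z)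
| CM5 a b x : acp_ax (CMerge (Cst a * x) (Cst b)) (Cst (gamma a b) * x)
| CM6 a b x : acp_ax (CMerge (Cst a) (Cst b * x)) (Cst (gamma a b) * x)
| CM7 a b x y :
    acp_ax (CMerge (Cst a * x) (Cst b * y)) (Cst (gamma a b) * Par x y)
| CM8 x y z : acp_ax (CMerge (x + y) z) (CMerge x z + CMerge y z)
| CM9 x y z : acp_ax (CMerge x (y + z)) (CMerge x y + CMerge x z)
| CM10 x : acp_ax (CMerge delta x) delta
| CM11 x : acp_ax (CMerge x delta) delta
| CM12 a b : acp_ax (CMerge (Cst a) (Cst b)) (Cst (gamma a b)).

Variables (P : acp_params) (Q : si_params P).
Local Notation term := (term (action P) (state Q)).

(* In SI3-SI5 the action [a] may be any action not of the form pcr(d).  The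
   presentation of siACP also excludes the actions rcr(d); but then no axiom
   applies to pi^1_{1,h,s}(rcr(d)), which arises from nested interleaving, and
   it is in general not derivably equal to any closed term without interleaving
   operators. *)
Inductive siacp_ax : term -> term -> Prop :=
| SI_acp l r : acp_ax l r -> siacp_ax l r
| SI1 n h s (ts : 'I_n.+1 -> term) :
    siacp_ax (Inter h s ts) (Pos (sched n h s) h s ts)
| SI2 n (i : 'I_n.+1) h s ts :
    siacp_ax (Pos i h s [eta ts with i |-> delta]) delta
| SI3 (i : 'I_1) h s a :
    (forall d : data Q, a <> pcr d) ->
    siacp_ax (Pos i h s (fun _ => act a)) (act a)
| SI4 n (i : 'I_n.+2) h s ts a :
    (forall d : data Q, a <> pcr d) ->
    siacp_ax (Pos i h s [eta ts with i |-> act a])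
             (act a * Inter (hext Q h (i.+1, n.+1)) (upd h s i a) (del i ts))
| SI5 n (i : 'I_n.+1) h s ts a x :
    (forall d : data Q, a <> pcr d) ->
    siacp_ax (Pos i h s [eta ts with i |-> act a * x])
             (act a * Inter (hext Q h (i.+1, n.+1)) (upd h s i a)
                            [eta ts with i |-> x])
| SI6 n (i : 'I_n.+1) h s ts (d : data Q) :
    siacp_ax (Pos i h s [eta ts with i |-> act (pcr d)])
             (act (rcr d) *
                Inter (hext Q h (i.+1, n.+1)) (upd h s i (pcr d))
                      (snoc (del i ts) (cr d)))
| SI7 n (i : 'I_n.+1) h s ts (d : data Q) x :
    siacp_ax (Pos i h s [eta ts with i |-> act (pcr d) * x])
             (act (rcr d) *
                Inter (hext Q h (i.+1, n.+2)) (upd h s i (pcr d))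
                      (snoc [eta ts with i |-> x] (cr d)))
| SI8 n (i : 'I_n.+1) h s ts x y :
    siacp_ax (Pos i h s [eta ts with i |-> x + y])
             (Pos i h s [eta ts with i |-> x] +
              Pos i h s [eta ts with i |-> y]).

Definition acp_spec : spec (action P) (state Q) -> Prop :=
  guarded_spec (@acp_term _ _) (@acp_term _ _) (@acp_ax P (state Q)).

(* Since cr(d) may contain recursion constants, so may terms obtained by SI6
   and SI7; the terms occurring in a rewriting are therefore over the signature
   of siACP plus the recursion constants occurring in the terms cr(d). *)
Definition siacp_spec : spec (action P) (state Q) -> Prop :=
  guarded_spec (@siacp_term _ _)
    (sig_in True (fun X E => exists d : data Q, const_in X E (cr d))) siacp_ax.

Definition acp_rec_term : term -> Prop :=
  sig_in False (fun X E => acp_spec E /\ in_vars E X).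

Definition siacp_rec_term : term -> Prop :=
  sig_in True (fun X E => siacp_spec E /\ in_vars E X).

(* The signature depends, through the notion of guarded recursive specification,
   on the axioms and hence on cr; so the requirement on the codomain of cr is
   imposed afterwards. *)
Definition cr_wf : Prop :=
  forall d : data Q, closed (cr d) /\ siacp_rec_term (cr d).

(* Derivability of an equation from the axioms of siACP_rec^+ in infinitary
   conditional equational logic; all terms involved are siACP_rec^+ terms. *)
Inductive derivable : term -> term -> Prop :=
| d_refl t : siacp_rec_term t -> derivable t t
| d_sym t u : derivable t u -> derivable u t
| d_trans t u v : derivable t u -> derivable u v -> derivable t v
| d_cong C t u :
    context C -> siacp_rec_term (C t) -> siacp_rec_term (C u) ->
    derivable t u -> derivable (C t) (C u)
| d_subst sigma t u :
    (forall X, siacp_rec_term (sigma X)) ->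
    derivable t u -> derivable (subst sigma t) (subst sigma u)
| d_ax l r :
    siacp_ax l r -> siacp_rec_term l -> siacp_rec_term r -> derivable l r
| d_rdp E X t :
    siacp_spec E -> E X = Some t -> derivable (Rec X E) (unfold_spec E t)
| d_rsp E sigma X :
    siacp_spec E -> (forall Y, siacp_rec_term (sigma Y)) ->
    (forall Y t, E Y = Some t -> derivable (sigma Y) (subst sigma t)) ->
    in_vars E X -> derivable (sigma X) (Rec X E).

End Theories.

(* Main.v *)
From Stdlib Require Import Relation_Operators.
From Stdlib Require Import FunctionalExtensionality Classical ClassicalEpsilon.
From mathcomp Require Import all_boot.
Require Import Defs.

(** Every closed term is derivably equal to a finite sum of terms [a] and
    [a * x] with [x] closed: for the interleaving operators this is what SI1-SI8
    achieve, and for <X|E> one unfolds [E] once and uses that its right-hand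
    sides are rewritable to guarded ones.  Iterating, the residuals of a closed
    term form a finitely branching tree.  The nodes of this tree solve a
    countable guarded recursive specification over ACP, so RSP equates the term
    with a recursion constant of ACP. *)

Set Implicit Arguments.
Unset Strict Implicit.
Unset Printing Implicit Defensive.

(** * Signatures, substitution, guardedness and contexts of raw terms *)

Section RawTerms.
Variables A S : Type.
Implicit Types (t u l : term A S) (sigma tau : nat -> term A S).
Local Open Scope process_scope.

Lemma sig_inW (I I' : Prop) (K K' : nat -> spec A S -> Prop) t :
  (I -> I') -> (forall X E, K X E -> K' X E) ->
  sig_in I K t -> sig_in I' K' t.
Proof.
move=> II' KK'; elim: t => //=; try by move=> t IHt u IHu [/IHt ? /IHu].
- by move=> n h s ts IH [/II' ? H]; split=> // j; exact: IH.
- by move=> n i h s ts IH [/II' ? H]; split=> // j; exact: IH.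
Qed.

Lemma sig_in_subst (I : Prop) (K : nat -> spec A S -> Prop) sigma t :
  (forall X, sig_in I K (sigma X)) -> sig_in I K t ->
  sig_in I K (subst sigma t).
Proof.
move=> Hs; elim: t => //=; try by move=> t IHt u IHu [/IHt ? /IHu].
- by move=> n h s ts IH [? H]; split=> // j; exact: IH.
- by move=> n i h s ts IH [? H]; split=> // j; exact: IH.
Qed.

Lemma sig_in_const (I : Prop) (K : nat -> spec A S -> Prop) X E t :
  sig_in I K t -> const_in X E t -> K X E.
Proof.
elim: t => //=; try by move=> t IHt u IHu [Ht Hu] [/(IHt Ht)|/(IHu Hu)].
- by move=> n h s ts IH [_ H] [j]; apply: IH.
- by move=> n i h s ts IH [_ H] [j]; apply: IH.
- by move=> Y F H [<- <-].
Qed.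

Lemma vars_in_all (V : nat -> Prop) t : (forall X, V X) -> vars_in V t.
Proof. by move=> HV; elim: t => //=. Qed.

Lemma closed_subst (V : nat -> Prop) sigma t :
  (forall X, V X -> closed (sigma X)) -> vars_in V t ->
  closed (subst sigma t).
Proof.
rewrite /closed => Hs; elim: t => //=;
  try by move=> t IHt u IHu [/IHt ? /IHu].
- by move=> n h s ts IH H j; exact: IH.
- by move=> n i h s ts IH H j; exact: IH.
Qed.

Lemma closed_guarded t : closed t -> guarded t.
Proof.
rewrite /closed; elim: t => //=; try by move=> t IHt u IHu [/IHt ? /IHu].
- by move=> t IHt u IHu [/IHt Gt /IHu ?]; case: t {IHt} Gt => // -[].
- by move=> n h s ts IH H j; exact: IH.
- by move=> n i h s ts IH H j; exact: IH.
Qed.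

Lemma guarded_seq t u :
  guarded (t * u) -> (exists a, t = act a) \/ guarded t /\ guarded u.
Proof.
case: t => //=; try by right.
by case=> [a _|]; [left; exists a | right].
Qed.

Lemma guarded_subst sigma t : guarded t -> guarded (subst sigma t).
Proof.
elim: t => //=; try by move=> t IHt u IHu [/IHt ? /IHu].
- move=> t IHt u IHu /guarded_seq [[a ->] //|[/IHt Ht /IHu Hu]].
  by case: (subst sigma t) Ht => // -[].
- by move=> n h s ts IH H j; exact: IH.
- by move=> n i h s ts IH H j; exact: IH.
Qed.

Lemma subst_id t : subst Var t = t.
Proof.
elim: t => //= [t -> u -> |t -> u -> |t -> u -> |t -> u -> |t -> u -> |H t ->
  |n h s ts IH|n i h s ts IH] //; congr (_ _ _ _); exact: functional_extensionality.
Qed.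

Lemma subst_comp sigma tau t :
  subst sigma (subst tau t) = subst (fun X => subst sigma (tau X)) t.
Proof.
elim: t => //= [t -> u -> |t -> u -> |t -> u -> |t -> u -> |t -> u -> |H t ->
  |n h s ts IH|n i h s ts IH] //; congr (_ _ _ _); exact: functional_extensionality.
Qed.

(** Puts an arbitrary tuple into the form with one marked position that the left-hand sides of SI2
    and SI4-SI8 have. *)
Lemma with_id n (ts : 'I_n -> term A S) i : [eta ts with i |-> ts i] = ts :> ('I_n -> term A S).
Proof. by apply: functional_extensionality => j /=; case: eqP => [->|]. Qed.

Lemma with_all (R : term A S -> Prop) n (ts : 'I_n -> term A S) i t :
  (forall j, R (ts j)) -> R t -> forall j, R ([eta ts with i |-> t] j).
Proof. by move=> Hts Ht j /=; case: eqP. Qed.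

Lemma subst_with sigma n (ts : 'I_n -> term A S) i t :
  (fun j => subst sigma ([eta ts with i |-> t] j)) =
  [eta (fun j => subst sigma (ts j)) with i |-> subst sigma t]
  :> ('I_n -> term A S).
Proof. by apply: functional_extensionality => j /=; case: eqP. Qed.

(** Substitution acts separately on the hole and on the side terms, so [C'] is [C] with its side
    terms instantiated. This carries a rewrite inside an open term over to its instances. *)
Lemma context_subst sigma (C : term A S -> term A S) : context C ->
  exists2 C', context C' & forall t, subst sigma (C t) = C' (subst sigma t).
Proof.
elim=> [|D u _ [D' HD' E]|D u _ [D' HD' E]|D u _ [D' HD' E]|D u _ [D' HD' E]
  |D u _ [D' HD' E]|D u _ [D' HD' E]|D u _ [D' HD' E]|D u _ [D' HD' E]
  |D u _ [D' HD' E]|D u _ [D' HD' E]|D H _ [D' HD' E]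
  |D n h s ts k _ [D' HD' E]|D n i h s ts k _ [D' HD' E]].
- by exists id => //; exact: ctx_hole.
- by eexists; first exact: (ctx_alt_l (subst sigma u) HD'); move=> t /=; rewrite E.
- by eexists; first exact: (ctx_alt_r (subst sigma u) HD'); move=> t /=; rewrite E.
- by eexists; first exact: (ctx_seq_l (subst sigma u) HD'); move=> t /=; rewrite E.
- by eexists; first exact: (ctx_seq_r (subst sigma u) HD'); move=> t /=; rewrite E.
- by eexists; first exact: (ctx_par_l (subst sigma u) HD'); move=> t /=; rewrite E.
- by eexists; first exact: (ctx_par_r (subst sigma u) HD'); move=> t /=; rewrite E.
- by eexists; first exact: (ctx_lmerge_l (subst sigma u) HD'); move=> t /=; rewrite E.
- by eexists; first exact: (ctx_lmerge_r (subst sigma u) HD'); move=> t /=; rewrite E.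
- by eexists; first exact: (ctx_cmerge_l (subst sigma u) HD'); move=> t /=; rewrite E.
- by eexists; first exact: (ctx_cmerge_r (subst sigma u) HD'); move=> t /=; rewrite E.
- by eexists; first exact: (ctx_encap H HD'); move=> t /=; rewrite E.
- eexists; first exact: (ctx_inter h s (fun j => subst sigma (ts j)) k HD').
  by move=> t; cbv beta; rewrite -E -subst_with.
- eexists; first exact: (ctx_pos i h s (fun j => subst sigma (ts j)) k HD').
  by move=> t; cbv beta; rewrite -E -subst_with.
Qed.

Lemma sig_in_context (I : Prop) (K : nat -> spec A S -> Prop) C t :
  context C -> sig_in I K (C t) -> sig_in I K t.
Proof.
elim=> //=; try by move=> D u _ IH [? ?]; exact: IH.
- by move=> D n h s ts k _ IH [_ /(_ k)]; rewrite eqxx.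
- by move=> D n i h s ts k _ IH [_ /(_ k)]; rewrite eqxx.
Qed.

Lemma sig_in_replace (I : Prop) (K : nat -> spec A S -> Prop) C t u :
  context C -> sig_in I K u -> sig_in I K (C t) -> sig_in I K (C u).
Proof.
move=> HC Hu; elim: HC => //=; try by move=> D v _ IH [? ?]; split; auto.
- move=> D n h s ts k _ IH [HI H]; split=> // j.
  by move: (H j); case: eqP.
- move=> D n i h s ts k _ IH [HI H]; split=> // j.
  by move: (H j); case: eqP.
Qed.

End RawTerms.

(** * Derivable equations and head normal forms *)

Section HeadNormalForms.
Variables (P : acp_params) (Q : si_params P).
Local Notation term := (term (action P) (state Q)).
Implicit Types (t u x y l : term) (sigma : nat -> term).
Local Notation rterm := (@siacp_rec_term P Q).
Local Open Scope process_scope.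

Definition process t : Prop := closed t /\ rterm t.

Lemma siacp_rec_unfold E t :
  siacp_spec E -> rterm t -> rterm (unfold_spec E t).
Proof.
move=> HE; apply: sig_in_subst => X /=; case EX: (E X) => [u|] //=.
by split=> //; rewrite /in_vars EX.
Qed.

Lemma siacp_term_rec t : siacp_term t -> rterm t.
Proof. exact: sig_inW. Qed.

(** Most rules have this as a side condition. For RDP, a right-hand side is a siACP term, and
    unfolding adds only constants of the same guarded specification. *)
Lemma derivable_rec t u : derivable t u -> rterm t /\ rterm u.
Proof.
elim=> {t u} //.
- by move=> t u _ [].
- by move=> t u v _ [? _] _ [].
- move=> sigma t u Hs _ [Ht Hu]; split; exact: sig_in_subst.
- move=> E X t HE EX; split; first by split=> //; rewrite /in_vars EX.
  by apply: siacp_rec_unfold => //; apply: siacp_term_rec; case: (HE _ _ EX).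
Qed.

Lemma derivable_context C t u :
  context C -> rterm (C u) -> derivable t u -> derivable (C t) (C u).
Proof.
move=> HC Hu Htu; have [Ht _] := derivable_rec Htu.
by apply: d_cong => //; exact: sig_in_replace Hu.
Qed.

(** Having a head normal form. Because [headed_eq] closes the notion under derivable equality, no
    normal form has to be named, and an induction meets the summands themselves plus one rewriting
    case. Residuals are only required to be processes; the term itself may be open. *)
Inductive headed : term -> Prop :=
| headed_delta : headed delta
| headed_act a : headed (act a)
| headed_prefix a x : process x -> headed (act a * x)
| headed_alt t u : headed t -> headed u -> headed (t + u)
| headed_eq t u : derivable t u -> headed u -> headed t.

Lemma headed_rec t : headed t -> rterm t.
Proof.
elim=> // [a x [_ Hx] //|t' u Htu _ _].
by case: (derivable_rec Htu).
Qed.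

Lemma headed_ax t u : siacp_ax t u -> rterm t -> headed u -> headed t.
Proof.
move=> Htu Ht Hu; apply: headed_eq (Hu); apply: d_ax => //; exact: headed_rec.
Qed.

Lemma headed_acp t u : acp_ax t u -> rterm t -> headed u -> headed t.
Proof. by move=> Htu; apply: headed_ax; exact: SI_acp. Qed.

Lemma headed_context C t u :
  context C -> derivable t u -> headed (C u) -> headed (C t).
Proof.
move=> HC Htu Hu; apply: headed_eq (Hu).
by apply: derivable_context => //; exact: headed_rec.
Qed.

(** * Head normal forms under the operators of ACP *)

Lemma headed_cst c : headed (Cst c).
Proof. by case: c => [a|]; [exact: headed_act | exact: headed_delta]. Qed.

(** Covers the results of CM5-CM7, where [gamma a b] may be delta; A7 then removes the residual. *)
Lemma headed_cst_seq c x : process x -> headed (Cst c * x).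
Proof.
move=> Hx; case: c => [a|]; first exact: headed_prefix.
by apply: (headed_acp (A7 _)); [case: Hx | exact: headed_delta].
Qed.

Lemma process_par x y : process x -> process y -> process (Par x y).
Proof. by move=> [? ?] [? ?]. Qed.

Lemma headed_seq t x : headed t -> process x -> headed (t * x).
Proof.
move=> Ht Hx; have [cx rx] := Hx; elim: Ht => {t}.
- exact: headed_cst_seq.
- by move=> a; exact: headed_prefix.
- move=> a y [cy ry]; apply: (headed_acp (A5 _ _ _)) => //.
  by apply: headed_prefix.
- move=> t u Ht IHt Hu IHu; apply: (headed_acp (A4 _ _ _)) => //.
    by do !split=> //; exact: headed_rec.
  exact: headed_alt.
- move=> t u Htu _; apply: (@headed_context (fun y => y * x)) => //.
  exact/ctx_seq_l/ctx_hole.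
Qed.

Lemma headed_lmerge t x : headed t -> process x -> headed (LMerge t x).
Proof.
move=> Ht Hx; have [cx rx] := Hx; elim: Ht => {t}.
- by apply: (headed_acp (CM2 _ _)) => //; exact: headed_cst_seq.
- by move=> a; apply: (headed_acp (CM2 _ _)) => //; exact: headed_prefix.
- move=> a y Hy; have [_ ry] := Hy; apply: (headed_acp (CM3 _ _ _)) => //.
  exact/headed_prefix/process_par.
- move=> t u Ht IHt Hu IHu; apply: (headed_acp (CM4 _ _ _)) => //.
    by do !split=> //; exact: headed_rec.
  exact: headed_alt.
- move=> t u Htu _; apply: (@headed_context (fun y => LMerge y x)) => //.
  exact/ctx_lmerge_l/ctx_hole.
Qed.

(** Nested induction: CM8 splits sums on the left, and for a fixed left summand CM9 splits sums on
    the right. *)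
Lemma headed_cmerge t u : headed t -> headed u -> headed (CMerge t u).
Proof.
move=> Ht Hu; have ru := headed_rec Hu; elim: Ht => {t}.
- by apply: (headed_acp (CM10 _)) => //; exact: headed_delta.
- move=> a; elim: Hu {ru} => {u}.
  + by apply: (headed_acp (CM11 _)) => //; exact: headed_delta.
  + by move=> b; apply: (headed_acp (CM12 _ _ _)) => //; exact: headed_cst.
  + move=> b y Hy; have [_ ry] := Hy; apply: (headed_acp (CM6 _ _ _)) => //.
    exact: headed_cst_seq.
  + move=> t u Ht IHt Hu IHu; apply: (headed_acp (CM9 _ _ _)) => //.
      by do !split=> //; exact: headed_rec.
    exact: headed_alt.
  + move=> t u Htu _; apply: (@headed_context (CMerge _)) => //.
    exact/ctx_cmerge_r/ctx_hole.
- move=> a x Hx; have [_ rx] := Hx; elim: Hu {ru} => {u}.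
  + by apply: (headed_acp (CM11 _)) => //; exact: headed_delta.
  + move=> b; apply: (headed_acp (CM5 _ _ _)) => //; exact: headed_cst_seq.
  + move=> b y Hy; have [_ ry] := Hy; apply: (headed_acp (CM7 _ _ _ _)) => //.
    exact/headed_cst_seq/process_par.
  + move=> t u Ht IHt Hu IHu; apply: (headed_acp (CM9 _ _ _)) => //.
      by do !split=> //; exact: headed_rec.
    exact: headed_alt.
  + move=> t u Htu _; apply: (@headed_context (CMerge _)) => //.
    exact/ctx_cmerge_r/ctx_hole.
- move=> t v Ht IHt Hv IHv; apply: (headed_acp (CM8 _ _ _)) => //.
    by do !split=> //; exact: headed_rec.
  exact: headed_alt.
- move=> t v Htv _; apply: (@headed_context (fun y => CMerge y u)) => //.
  exact/ctx_cmerge_l/ctx_hole.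
Qed.

(** After a step of one operand the whole other operand is part of the residual, hence the
    closedness conditions, which [headed] does not provide. *)
Lemma headed_par t u :
  headed t -> headed u -> closed t -> closed u -> headed (Par t u).
Proof.
move=> Ht Hu ct cu; have rt := headed_rec Ht; have ru := headed_rec Hu.
apply: (headed_acp (CM1 _ _)) => //.
apply: headed_alt; last exact: headed_cmerge.
by apply: headed_alt; apply: headed_lmerge.
Qed.

Lemma encap_cst (H : action P -> Prop) c :
  exists c', derivable (Encap H (Cst c)) (Cst c' : term).
Proof.
have [[b -> Hb]|nH] := classic (exists2 b, c = Some b & H b).
  by exists None; apply: d_ax => //; apply: SI_acp; exact: D2.
by exists c; apply: d_ax => //; apply: SI_acp; exact: D1.
Qed.

Lemma headed_encap H t : headed t -> headed (Encap H t).
Proof.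
have Hc c : headed (Encap H (Cst c)).
  by have [c' Hc'] := encap_cst H c; apply: headed_eq Hc' (headed_cst _).
elim=> {t} //.
(* D4 also puts the encapsulation on the action, which may turn it into delta; [Hc] covers both
   outcomes. *)
- move=> a x [cx rx]; apply: (headed_acp (D4 _ _ _)) => //.
  exact: headed_seq.
- move=> t u Ht IHt Hu IHu; apply: (headed_acp (D3 _ _ _)).
    by split; exact: headed_rec.
  exact: headed_alt.
- move=> t u Htu _; apply: (@headed_context (Encap H)) => //.
  exact/ctx_encap/ctx_hole.
Qed.

(** * Head normal forms under the interleaving operators *)

Lemma process_inter n h s (ts : 'I_n.+1 -> term) :
  (forall j, process (ts j)) -> process (Inter h s ts).
Proof. by move=> H; split=> [|/=]; [|split=> //] => j; case: (H j). Qed.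

Lemma process_snoc n (ts : 'I_n -> term) x :
  (forall j, process (ts j)) -> process x -> forall j, process (snoc ts x j).
Proof. by move=> Hts Hx j; rewrite /snoc; case: unlift. Qed.

Hypothesis hcr : cr_wf Q.

(** Only the argument at the selected position is analysed, each form of summand having its own
    axiom among SI2-SI8. The other arguments pass unchanged into the residual, so being processes is
    enough for them. *)
Lemma headed_pos n (i : 'I_n.+1) h s (ts : 'I_n.+1 -> term) t :
  (forall j, process (ts j)) -> headed t ->
  headed (Pos i h s [eta ts with i |-> t]).
Proof.
move=> Hts; have rpos u : rterm u -> rterm (Pos i h s [eta ts with i |-> u]).
  by move=> ru; split=> //; apply: with_all => // j; case: (Hts j).
elim=> {t}.
- by apply: (headed_ax (SI2 _ _ _ _)); [exact: rpos | exact: headed_delta].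
- move=> a; have ra := rpos (act a) I.
  (* For pcr(d), SI6 applies and the created process cr(d) is closed by [hcr]; every other action
     falls under SI3 or SI4. *)
  have [[d ad]|nd] := classic (exists d : data Q, a = pcr d).
    rewrite ad in ra *; apply: (headed_ax (SI6 _ _ _ _ _)) => //.
    apply/headed_prefix/process_inter/process_snoc => [j|]; first exact: Hts.
    exact: hcr.
  have {}nd (d : data Q) : a <> pcr d by move=> ad; apply: nd; exists d.
  (* SI3 ends the only remaining process; SI4 removes one of at least two. *)
  case: n i ts Hts {rpos} ra => [|n] i ts Hts ra.
    have E : [eta ts with i |-> act a] = (fun=> act a) :> ('I_1 -> term).
      by apply: functional_extensionality => j /=; rewrite !ord1 eqxx.
    rewrite E in ra *; apply: (headed_ax (SI3 _ _ _ _)) => //.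
    exact: headed_act.
  apply: (headed_ax (SI4 _ _ _ _ _)) => //.
  by apply/headed_prefix/process_inter => j; exact: Hts.
- move=> a x Hx; have [cx rx] := Hx; have ra := rpos (act a * x) (conj I rx).
  have Hts' := with_all i Hts Hx.
  have [[d ad]|nd] := classic (exists d : data Q, a = pcr d).
    rewrite ad in ra *; apply: (headed_ax (SI7 _ _ _ _ _ _)) => //.
    by apply/headed_prefix/process_inter/process_snoc => //; exact: hcr.
  have {}nd (d : data Q) : a <> pcr d by move=> ad; apply: nd; exists d.
  apply: (headed_ax (SI5 _ _ _ _ _ _)) => //.
  exact/headed_prefix/process_inter.
- move=> t u Ht IHt Hu IHu; apply: (headed_ax (SI8 _ _ _ _ _ _)).
    by apply: rpos; split; exact: headed_rec.
  exact: headed_alt.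
- move=> t u Htu _.
  apply: (@headed_context (fun y => Pos i h s [eta ts with i |-> y])) => //.
  exact/ctx_pos/ctx_hole.
Qed.

(** * Guarded terms and recursion constants *)

(** Guarded variables occur only behind an action prefix, where a process is all that is needed, so
    the terms [sigma X] need no head normal form. The parameter [K] avoids a circularity: the lemma
    is used first without recursion constants, to show that each <X|E> is headed, and then with all
    of them. *)
Lemma headed_subst (K : nat -> spec (action P) (state Q) -> Prop)
    (V : nat -> Prop) sigma t :
  (forall X E, K X E -> headed (Rec X E)) ->
  (forall X, rterm (sigma X)) -> (forall X, V X -> closed (sigma X)) ->
  sig_in True K t -> guarded t -> vars_in V t -> headed (subst sigma t).
Proof.
move=> HK rs cs.
have Hp u : sig_in True K u -> vars_in V u -> process (subst sigma u).
  move=> Su Vu; split; first exact: closed_subst Vu.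
  by apply: sig_in_subst => //; apply: sig_inW Su => // X E /HK /headed_rec.
elim: t => //=.
- by move=> c *; exact: headed_cst.
- move=> t IHt u IHu [St Su] [Gt Gu] [Vt Vu]; apply: headed_alt; auto.
- move=> t IHt u IHu [St Su] /guarded_seq [[a ->]|[Gt Gu]] [Vt Vu].
    by apply: headed_prefix; exact: Hp.
  by apply: headed_seq; [exact: IHt | exact: Hp].
- move=> t IHt u IHu [St Su] [Gt Gu] [Vt Vu]; apply: headed_par; auto.
    by case: (Hp t).
  by case: (Hp u).
- by move=> t IHt u IHu [St Su] [Gt Gu] [Vt Vu]; apply: headed_lmerge; auto.
- by move=> t IHt u IHu [St Su] [Gt Gu] [Vt Vu]; apply: headed_cmerge; auto.
- by move=> H t IHt St Gt Vt; apply: headed_encap; auto.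
- move=> n h s ts IH [_ Sts] Gts Vts.
  have Hts j : process (subst sigma (ts j)) by apply: Hp.
  (* SI1 reduces to the position operator chosen by the scheduler, whose tuple is then written with
     that position marked. *)
  apply: (headed_ax (SI1 _ _ _)); first by case: (process_inter h s Hts).
  by rewrite -(with_id (fun j => subst sigma (ts j)) (sched _ h s)); apply: headed_pos; auto.
- move=> n i h s ts IH [_ Sts] Gts Vts; rewrite -(with_id (fun j => subst sigma (ts j)) i).
  by apply: headed_pos; auto.
- by move=> X E /HK.
Qed.

Local Notation cr_term :=
  (sig_in True (fun X E => exists d : data Q, const_in X E (cr d))).

(** Rewriting by SI6 and SI7 may introduce constants from cr(d); [cr_wf] makes them constants of the
    theory. *)
Lemma cr_term_rec t : cr_term t -> rterm t.
Proof.
apply: sig_inW => // X E [d Xd].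
by have [_ rd] := hcr d; exact: (sig_in_const rd Xd).
Qed.

(** Under unfolding, an axiom step becomes an instance of that axiom, and replacing [Y] by its
    right-hand side becomes RDP. *)
Lemma derivable_rewrite E X t u :
  siacp_spec E -> rewrite_step cr_term (@siacp_ax P Q) E X t u ->
  derivable (unfold_spec E t) (unfold_spec E u).
Proof.
move=> HE [/cr_term_rec rt /cr_term_rec ru [C [l [r [HC tE uE Hlr]]]]].
rewrite {}tE {}uE in rt ru *.
have rl := sig_in_context HC rt; have rr := sig_in_context HC ru.
have rVar Y : rterm (unfold_spec E (Var Y)) by exact: siacp_rec_unfold.
have [C' HC' C'E] := context_subst (fun Y => unfold_spec E (Var Y)) HC.
have rC' v : rterm (C v) -> rterm (C' (unfold_spec E v)).
  by move=> rv; rewrite -C'E; apply: sig_in_subst.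
rewrite /unfold_spec !C'E; apply: derivable_context => //; first exact: rC'.
case: Hlr => [lr|rl'|[Y [_ -> EY]]].
- by apply: d_subst => //; exact: d_ax.
- by apply: d_subst => //; apply: d_sym; exact: d_ax.
- by rewrite /unfold_spec /= EY; exact: d_rdp.
Qed.

Lemma headed_rec_const E X :
  siacp_spec E -> in_vars E X -> headed (Rec X E).
Proof.
rewrite /in_vars => HE; case EX: (E X) => [t|] // _.
have [St [u [Htu Su Gu Vu]]] := HE X t EX.
have Du : derivable (unfold_spec E t) (unfold_spec E u).
  (* The signature condition is carried through the induction, since reflexivity requires it; at
     intermediate terms it comes from [derivable_rec]. *)
  have := siacp_rec_unfold HE (siacp_term_rec St).
  elim: Htu => {t u EX St Su Gu Vu} [t u Htu _|t|t u v _ IHt _ IHu /IHt Dt].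
  - exact: derivable_rewrite Htu.
  - exact: d_refl.
  - by have [_ /IHu] := derivable_rec Dt; exact: d_trans.
apply: headed_eq (d_trans (d_rdp HE EX) Du) _.
(* The guarded term [u] is over siACP and has no recursion constants of its own; the constants of
   [E] enter only in place of its guarded variables. *)
apply: (headed_subst (K := fun _ _ => False) (V := in_vars E)) => //.
- by move=> Y; apply: (siacp_rec_unfold (t := Var Y)).
- by move=> Y; rewrite /in_vars; case: (E Y).
Qed.

(** A closed term is vacuously guarded and is its own instance under the identity substitution. *)
Lemma process_headed t : process t -> headed t.
Proof.
move=> [ct rt]; rewrite -[t]subst_id.
apply: (headed_subst (V := fun=> False) _ _ _ rt) => //.
- by move=> X E [HE EX]; exact: headed_rec_const.
- exact: closed_guarded.
Qed.

(** * The ACP specification of all residuals *)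

(** Separates the ACP shape [l] of a head normal form from the residuals [sigma]; the shapes become
    right-hand sides of the final specification. *)
Lemma headed_guarded t : headed t ->
  exists l sigma, [/\ acp_term l, guarded l, forall X, process (sigma X) &
    derivable t (subst sigma l)].
Proof.
have pd : process delta by [].
elim=> {t}.
- by exists delta, (fun=> delta); split=> //; exact: d_refl.
- by move=> a; exists (act a), (fun=> delta); split=> //; exact: d_refl.
- move=> a x Hx; exists (act a * Var 0), (fun=> x); split=> //=.
  by apply: d_refl; case: Hx.
- move=> t u _ [l1 [sigma1 [S1 G1 p1 D1]]] _ [l2 [sigma2 [S2 G2 p2 D2]]].
  (* Even variables hold the residuals of the first summand, odd ones those of the second. *)
  exists (subst (fun X => Var X.*2) l1 + subst (fun X => Var X.*2.+1) l2).
  exists (fun X => if odd X then sigma2 X./2 else sigma1 X./2); split=> /=.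
  + by split; exact: sig_in_subst.
  + by split; exact: guarded_subst.
  + by move=> X; case: odd.
  + rewrite !subst_comp /=.
    have -> : (fun X => if odd X.*2 then sigma2 X.*2./2 else sigma1 X.*2./2)
        = sigma1.
      by apply: functional_extensionality => X; rewrite odd_double doubleK.
    have -> : (fun X => if ~~ odd X.*2 then sigma2 (uphalf X.*2)
                        else sigma1 (uphalf X.*2)) = sigma2.
      by apply: functional_extensionality => X; rewrite odd_double uphalf_double.
    have [[rt r1] [ru r2]] := (derivable_rec D1, derivable_rec D2).
    apply: (@d_trans _ _ _ (subst sigma1 l1 + u)).
      apply: (@derivable_context (fun y => y + u)) => //.
      exact/ctx_alt_l/ctx_hole.
    apply: (@derivable_context (Alt _)) => //.
    exact/ctx_alt_r/ctx_hole.
- move=> t u Htu _ [l [sigma [Sl Gl pl Dl]]].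
  by exists l, sigma; split=> //; exact: d_trans Dl.
Qed.

End HeadNormalForms.

Theorem theorem2 (P : acp_params) (Q : si_params P) (hcr : cr_wf Q)
    (t : term (action P) (state Q)) :
  closed t -> siacp_rec_term t ->
  exists t' : term (action P) (state Q),
    closed t' /\ acp_rec_term t' /\ derivable t t'.
Proof.
move=> ct rt.
pose R (u : term (action P) (state Q)) lsigma :=
  [/\ acp_term lsigma.1, guarded lsigma.1,
      forall X, process (lsigma.2 X) & derivable u (subst lsigma.2 lsigma.1)].
(* Choice fixes one shape and one family of residuals for every process; the subtype lets the
   passage to a residual be iterated. *)
have [f fP] : exists f, forall u : {u | process u}, R (sval u) (f u).
  have Rex (u : {u | process u}) : {lsigma | R (sval u) lsigma}.
    apply: constructive_indefinite_description.
    have [l [sigma H]] := headed_guarded (process_headed hcr (proj2_sig u)).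
    by exists (l, sigma).
  by exists (fun u => sval (Rex u)) => u; exact: proj2_sig.
pose head u := (f u).1.
pose next u X : {u | process u} :=
  exist _ ((f u).2 X) (let: And4 _ _ H _ := fP u in H X).
(* The tree of residuals is indexed by finite sequences of variables, read from the root [t], and is
   thus countable. *)
pose residual := foldl next (exist _ t (conj ct rt)).
(* A number that codes no sequence is given the root's path, so [E] defines every variable. *)
pose path X : seq nat := odflt [::] (unpickle X).
have pathK p : path (pickle p) = p by rewrite /path pickleK.
pose E : spec (action P) (state Q) := fun X =>
  Some (subst (fun Y => Var (pickle (rcons (path X) Y)))
              (head (residual (path X)))).
(* Needed over siACP for RSP and over ACP for the resulting constant. The right-hand sides are
   already guarded, so zero rewriting steps suffice in both. *)
have EP lang ax T : (forall u, acp_term u -> T u) -> guarded_spec T lang ax E.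
  move=> HT X _ [<-]; have [Sl Gl _ _] := fP (residual (path X)).
  have Sr : acp_term (subst (fun Y => Var (pickle (rcons (path X) Y)))
                            (head (residual (path X)))) by exact: sig_in_subst.
  split; first exact: HT.
  eexists; split; [exact: rt_refl | exact: HT | exact: guarded_subst |].
  exact: vars_in_all.
have HE : siacp_spec E by apply: EP => u; exact: sig_inW.
exists (Rec (pickle ([::] : seq nat)) E); split=> //; split.
  by split=> //; exact: EP.
(* The solution sends each variable to the residual at its path; the empty path gives [t]. *)
have := @d_rsp P Q E (fun X => sval (residual (path X)))
  (pickle ([::] : seq nat)) HE.
rewrite pathK; apply => //.
- by move=> Y; case: (proj2_sig (residual (path Y))).
- move=> Y _ [<-]; rewrite subst_comp /=.
  have [_ _ _] := fP (residual (path Y)); congr (derivable _ (subst _ _)).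
  (* The residual at the path extended by [X] is the child chosen by [X], which is what the renaming
     in [E] expresses. *)
  apply: functional_extensionality => X.
  by rewrite pathK /residual foldl_rcons.
Qed.
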